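(* Let $\mathfrak X$ be a homogeneous tree of degree $q+1$ ($q\geq1$) and fix an integer $k\geq 2$. For arbitrary functions $g,h\in\mathcal F(\mathfrak X)$, there exist infinitely many waves $\{f_j\}_{j\in\mathbb Z}$ on $\mathfrak X$ such that $f_0=g$ and $f_k=h$.
   Context: $\mathfrak X$ is a tree in which every vertex has exactly $q+1$ edges; $\mathcal F(\mathfrak X)$ is the space of complex-valued functions on its vertices; $\mu_1f(v)=\frac{1}{q+1}\sum_{w\text{ adjacent to }v}f(w)$. A wave is a family $\{f_j\}_{j\in\mathbb Z}$ in $\mathcal F(\mathfrak X)$ with $\mu_1f_j=\frac{f_{j+1}+f_{j-1}}{2}$ for all $j\in\mathbb Z$. *)

(* Defs.v *)
From mathcomp Require Import all_boot all_order all_algebra.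
From mathcomp Require Import all_classical all_reals.
From mathcomp Require Import complex.

Set Implicit Arguments.
Unset Strict Implicit.
Unset Printing Implicit Defensive.

Import Order.TTheory GRing.Theory Num.Theory.
Local Open Scope classical_set_scope.
Local Open Scope ring_scope.

Definition neighbours (V : choiceType) (adj : rel V) (v : V) : set V :=
  [set w | adj v w].

(* [ucycle adj [:: v; w]] holds on every edge, so genuine cycles are those of
   length at least 3. A tree is required to have a vertex. *)
Record is_tree (V : choiceType) (adj : rel V) : Prop := IsTree {
  tree_sym : symmetric adj;
  tree_irr : irreflexive adj;
  tree_nonempty : exists v : V, True;
  tree_connected : forall v w : V, exists p : seq V,
    path adj v p /\ last v p = w;
  tree_acyclic : forall c : seq V, ucycle adj c -> (size c < 3)%N
}.

Definition homogeneous_tree (q : nat) (V : choiceType) (adj : rel V) : Prop :=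
  is_tree adj /\ forall v : V, (neighbours adj v #= `I_q.+1)%card.

Definition mu1 (R : realType) (q : nat) (V : choiceType) (adj : rel V)
    (f : V -> R[i]) (v : V) : R[i] :=
  (q.+1%:R)^-1 * \sum_(w \in neighbours adj v) f w.

Definition wave (R : realType) (q : nat) (V : choiceType) (adj : rel V)
    (f : int -> V -> R[i]) : Prop :=
  forall (j : int) (v : V),
    mu1 q adj (f j) v = (f (j + 1) v + f (j - 1) v) / 2.

(* Main.v *)
(* A wave is determined by [f_0] and [f_1], and the recursion gives
   [f_k = W(mu_1) f_1 + U(mu_1) f_0] with [deg W = k - 1 >= 1] (Chebyshev
   polynomials).  So one has to solve [W(mu_1) f_1 = h - U(mu_1) g].  Over the
   complex numbers [W] splits into linear factors, and on a tree each
   [mu_1 - c] is onto with non-zero kernel, since functions can be prescribed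
   layer by layer away from a root.  Hence a solution [f_1] exists, and adding
   kernel elements of [W(mu_1)] gives infinitely many. *)
From HB Require Import structures.
Require Import Defs.
From mathcomp Require Import all_boot all_order all_algebra.
From mathcomp Require Import all_classical all_reals.
From mathcomp Require Import complex.

Set Implicit Arguments.
Unset Strict Implicit.
Unset Printing Implicit Defensive.

Import Order.TTheory GRing.Theory Num.Theory.
Local Open Scope classical_set_scope.
Local Open Scope ring_scope.

(** * Rooting a tree *)

(** If [u] and [w] differed, shortening the walk to a simple path and closing it up through [v]
    would give a cycle of length at least 3. *)
Lemma acyclic_detour (V : choiceType) (adj : rel V) (v u w : V) (p : seq V) :
  is_tree adj -> adj v u -> adj v w -> path adj u p -> last u p = w ->
  v \notin u :: p -> u = w.
Proof.
move=> [sym _ _ _ acyc] vu vw pp lp vp.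
case: (shortenP pp) lp => p' pp' up' sub' lp'; apply/eqP/negPn/negP => uw.
have vp' : v \notin u :: p'.
  apply: contra vp; rewrite !inE => /orP[->//|/sub' ->]; exact: orbT.
have /acyc : ucycle adj (v :: u :: p').
  by rewrite /ucycle /= vp' rcons_path pp' lp' vu sym vw.
by case: p' lp' uw {pp' up' sub' vp'} => //= ->; rewrite eqxx.
Qed.

(* [d] is the distance to a root, [par] the neighbour closer to the root. *)
Lemma tree_rooting (V : choiceType) (adj : rel V) : is_tree adj ->
  exists (d : V -> nat) (par : V -> V),
  [/\ exists r, d r = 0%N,
      forall v, (0 < d v)%N -> adj v (par v) /\ d v = (d (par v)).+1 &
      forall v w, adj v w -> (d w <= d v)%N -> (0 < d v)%N /\ w = par v].
Proof.
move=> tr; have [sym irr [r _] conn _] := tr.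
pose reach v n := `[< exists p, [/\ path adj r p, last r p = v & size p = n] >].
have ex v : exists n, reach v n.
  by have [p [pp lp]] := conn r v; exists (size p); apply/asboolP; exists p.
pose d v := ex_minn (ex v).
have dP v : exists p, [/\ path adj r p, last r p = v & size p = d v].
  by rewrite /d; case: ex_minnP => m /asboolP.
have dmin p : path adj r p -> (d (last r p) <= size p)%N.
  move=> pp; rewrite /d; case: ex_minnP => m _; apply.
  by apply/asboolP; exists p.
have d0 v : d v = 0%N -> v = r.
  by have [p [_ <- <-]] := dP v => /eqP/nilP ->.
have exu v : exists u, (0 < d v)%N -> adj v u /\ d v = (d u).+1.
  have [p [+ + sp]] := dP v; rewrite -sp.
  (* The predecessor of [v] on a shortest path from the root serves as its parent; minimality, used
     at both vertices, gives the exact depth. *)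
  case/lastP: p sp => [|p x] sp; first by exists r.
  rewrite rcons_path last_rcons => /andP[pp ax] xv; subst x.
  exists (last r p) => _; split; first by rewrite sym.
  apply/eqP; rewrite size_rcons eqSS eqn_leq dmin // andbT.
  have [p' [pp' lp' sp']] := dP (last r p).
  rewrite -sp' -ltnS -(size_rcons p v) sp -(size_rcons p' v).
  by rewrite -{1}(last_rcons r p' v) dmin // rcons_path pp' lp'.
pose par v := xget r [set u | (0 < d v)%N -> adj v u /\ d v = (d u).+1].
have parP v : (0 < d v)%N -> adj v (par v) /\ d v = (d (par v)).+1.
  rewrite /par; case: xgetP => [u _ //|nex].
  by have [u /nex] := exu v.
(* Following parents to [r] strictly lowers the depth, which later keeps [v] off the detour. *)
have down v : exists p,
    [/\ path adj v p, last v p = r & {in p, forall x, (d x < d v)%N}].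
  have [n dn] := ubnP (d v); elim: n v dn => // n IH v dn.
  have [/d0 ->|dv] := posnP (d v); first by exists [::].
  have [av dpar] := parP v dv.
  have [|p [pp lp lt]] := IH (par v); first by rewrite dpar in dn.
  exists (par v :: p); split; rewrite /= ?av // => x.
  by rewrite inE dpar ltnS => /orP[/eqP ->|/lt/ltnW].
(* The walk from [u] down to [r] and back up to [w] avoids [v]: its ends differ from [v] by
   irreflexivity, its other vertices have depth below [d v]. *)
have uniq v u w : adj v u -> adj v w -> (d u <= d v)%N -> (d w <= d v)%N -> u = w.
  move=> vu vw du dw.
  have [p [pp lp ltp]] := down u; have [s [ps ls lts]] := down w.
  have vN x t : adj v x -> (d x <= d v)%N ->
      {in t, forall y, (d y < d x)%N} -> v \notin x :: t.
    move=> vx dx lt; rewrite inE negb_or; apply/andP; split.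
      by apply: contraTneq vx => <-; rewrite irr.
    by apply/negP => /lt; rewrite ltnNge dx.
  have vs := vN _ _ vw dw lts.
  apply: (@acyclic_detour _ adj v u w (p ++ rev (belast w s))) => //.
  - rewrite cat_path pp lp -ls rev_path.
    by rewrite (eq_path (e' := adj)) // => x y; rewrite sym.
  - rewrite last_cat lp; case: (s) ls => [|y s'] //= _.
    by rewrite rev_cons last_rcons.
  rewrite -cat_cons mem_cat mem_rev negb_or vN //=.
  by apply: contra vs => /mem_belast.
exists d, par; split=> //.
  exists r; apply/eqP; rewrite -leqn0; exact: (dmin [::]).
move=> v w vw dw; have [dv|dv] := posnP (d v).
  move: dw vw; rewrite dv leqn0 => /eqP/d0 ->.
  by rewrite (d0 _ dv) irr.
by have [vp dp] := parP v dv; split=> //; apply: (uniq v); rewrite // dp.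
Qed.

(** * The spherical mean: surjectivity and eigenfunctions *)

Section SphericalMean.
Variables (R : realType) (q : nat) (V : choiceType) (adj : rel V).
Hypothesis deg : forall v : V, (neighbours adj v #= `I_q.+1)%card.
Let C := R[i].

Lemma finite_neighbours v : finite_set (neighbours adj v).
Proof. by exists q.+1; exact: deg. Qed.

(* [mu1] on functions with values in the regular module [C^o], so that it can be
   a linear endomorphism of an [lmodType]. *)
Definition mean (f : V -> C^o) : V -> C^o := mu1 q adj f.

Lemma mean_is_linear : linear mean.
Proof.
move=> a f g; apply/funext => v.
rewrite -[RHS]/(a * mean f v + mean g v) /mean /mu1 !(fsbig_finite _ _ (finite_neighbours v)) /=.
rewrite big_split mulrDr; congr (_ + _).
by rewrite mulrCA -mulr_sumr.
Qed.

HB.instance Definition _ :=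
  GRing.isLinear.Build C (V -> C^o) (V -> C^o) *:%R mean mean_is_linear.

Definition mean_linear : {linear (V -> C^o) -> (V -> C^o)} := mean.

Hypotheses (q_gt0 : (0 < q)%N) (tree : is_tree adj).

(* Propagate [f] away from the root: the equation at [v] prescribes the sum of [f]
   over the children of [v] (there are [q], or [q.+1] at the root), and this sum
   is divided equally among them. *)
Lemma mean_shift (c t : C) (g : V -> C^o) : exists f : V -> C^o,
  mean f - c *: f = g /\ exists r, f r = t.
Proof.
have [d [par [[r dr] parP parU]]] := tree_rooting tree.
(* The sum over the neighbours of [v] that the equation at [v] demands when [f v = x]. *)
pose s v x := q.+1%:R * (c * x + g v).
(* Recursion runs on the depth, the intended use being [n = d w], since [par] is no structural
   descent. The divisor counts the children of [v]. *)
pose fix F (n : nat) (w : V) {struct n} : C :=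
  if n is m.+1 then
    let v := par w in
    (s v (F m v) - (if m is l.+1 then F l (par v) else 0)) / (q + (d v == 0%N))%:R
  else t.
pose f w := F (d w) w.
have fE w v : par w = v -> d w = (d v).+1 ->
   f w = (s v (f v) - (if (0 < d v)%N then f (par v) else 0)) / (q + (d v == 0%N))%:R.
  rewrite {1}/f => pw ->; rewrite /= pw /f; congr ((_ - _) / _).
  case: posnP => [-> //|dv]; have [_ dpv] := parP v dv.
  by rewrite dpv.
exists f; split; last by exists r; rewrite /f dr.
(* A neighbour other than the parent lies strictly deeper, so its own parent is [v]. *)
have child v w : adj v w -> ((0 < d v)%N -> w <> par v) ->
   f w = (s v (f v) - (if (0 < d v)%N then f (par v) else 0)) / (q + (d v == 0%N))%:R.
  move=> vw nw; have lt : (d v < d w)%N.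
    by rewrite ltnNge; apply/negP => le; have [dv] := parU v w vw le; apply: nw.
  have wv : adj w v by rewrite (tree_sym tree).
  have [dw vpar] := parU w v wv (ltnW lt).
  by apply: fE => //; rewrite vpar; have [] := parP w dw.
have sumE v : \sum_(w \in neighbours adj v) f w = s v (f v).
  have fin := finite_neighbours v.
  have mem_nbh w : (w \in finmap.enum_fset (fset_set (neighbours adj v))) = adj v w.
    by apply: etrans (in_fset_set fin w) _; apply: asboolb.
  rewrite fsbig_finite //=.
  have nzq : q%:R != 0 :> C by rewrite pnatr_eq0 -lt0n.
  have nzq1 : q.+1%:R != 0 :> C by rewrite pnatr_eq0.
  have szE := card_fset_set (deg v).
  have [dv|dv] := posnP (d v).
    rewrite (eq_big_seq (fun=> s v (f v) / q.+1%:R)) => [|w].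
      by rewrite big_const_seq count_predT szE iter_addr_0 -[LHS]mulr_natr mulfVK.
    rewrite mem_nbh => vw.
    by rewrite (child v w) // dv //= subr0 addn1.
  have [vp _] := parP v dv.
  (* Away from the root the parent's term is split off, and the [q] children share the remainder. *)
  have pin : par v \in finmap.enum_fset (fset_set (neighbours adj v)).
    by rewrite mem_nbh.
  rewrite (big_rem _ pin) /=.
  rewrite (eq_big_seq (fun=> (s v (f v) - f (par v)) / q%:R)) => [|w].
    rewrite big_const_seq count_predT size_rem // szE iter_addr_0 -[X in _ + X]mulr_natr.
    by rewrite mulfVK // subrKC.
  rewrite mem_rem_uniq ?finmap.fset_uniq // inE => /andP[/eqP nw].
  rewrite mem_nbh => vw.
  by rewrite (child v w) // dv (gtn_eqF dv) addn0.
apply/funext => v.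
rewrite -[LHS]/(mu1 q adj f v - c * f v) /mu1 sumE /s mulKf ?pnatr_eq0 //.
by rewrite addrC addKr.
Qed.

Lemma mean_shift_onto (c : C) g : exists f, mean f - c *: f = g.
Proof. by have [f [fg _]] := mean_shift c 0 g; exists f. Qed.

(** With right-hand side 0 the value at the root is still free; choosing 1 there excludes the zero
    function. *)
Lemma mean_eigen (c : C) : exists2 f, f != 0 & mean f = c *: f.
Proof.
have [f [fg [r fr]]] := mean_shift c 1 0.
exists f; last by apply/eqP; rewrite -subr_eq0 fg.
by apply/eqP => f0; move/eqP: fr; rewrite f0 eq_sym oner_eq0.
Qed.

End SphericalMean.

(** * Polynomials in a linear operator *)

Section PolynomialAction.
Variables (F : closedFieldType) (M : lmodType F) (T : {linear M -> M}).

Definition polyact (p : {poly F}) (f : M) : M :=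
  \sum_(i < size p) p`_i *: iter i T f.

Lemma polyact_widen n (p : {poly F}) f : (size p <= n)%N ->
  polyact p f = \sum_(i < n) p`_i *: iter i T f.
Proof.
move=> le_pn; rewrite /polyact (big_ord_widen _ (fun i => p`_i *: iter i T f) le_pn).
rewrite big_mkcond; apply: eq_bigr => i _; case: ltnP => // le.
by rewrite nth_default ?scale0r.
Qed.

Lemma polyactC c f : polyact c%:P f = c *: f.
Proof. by rewrite (@polyact_widen 1) ?size_polyC_leq1 // big_ord1 coefC. Qed.

Lemma polyactD p1 p2 f : polyact (p1 + p2) f = polyact p1 f + polyact p2 f.
Proof.
pose n := maxn (size p1) (size p2).
rewrite !(@polyact_widen n) ?leq_maxl ?leq_maxr ?size_polyD // -big_split.
by apply: eq_bigr => i _; rewrite coefD scalerDl.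
Qed.

Lemma polyactZ c p f : polyact (c *: p) f = c *: polyact p f.
Proof.
rewrite (@polyact_widen (size p)) ?size_scale_leq // scaler_sumr.
by apply: eq_bigr => i _; rewrite coefZ scalerA.
Qed.

Lemma polyactB p1 p2 f : polyact (p1 - p2) f = polyact p1 f - polyact p2 f.
Proof. by rewrite polyactD -[- p2]scaleN1r polyactZ scaleN1r. Qed.

Lemma polyactX p f : polyact ('X * p) f = T (polyact p f).
Proof.
have le : (size ('X * p)%R <= (size p).+1)%N.
  by rewrite mulrC; apply: leq_trans (size_polyMleq _ _) _; rewrite size_polyX addn2.
rewrite (polyact_widen _ le) big_ord_recl mulrC coefMX scale0r add0r.
rewrite /polyact linear_sum; apply: eq_bigr => i _.
by rewrite coefMX linearZ.
Qed.

Lemma polyactXsubC z p f :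
  polyact (('X - z%:P) * p) f = T (polyact p f) - z *: polyact p f.
Proof. by rewrite mulrBl polyactB polyactX mul_polyC polyactZ. Qed.

Lemma polyact_linear p (a : F) f g :
  polyact p (a *: f + g) = a *: polyact p f + polyact p g.
Proof.
rewrite /polyact scaler_sumr -big_split; apply: eq_bigr => i _ /=.
have -> : iter i T (a *: f + g) = a *: iter i T f + iter i T g.
  by elim: (i : nat) => //= n ->; rewrite linearP.
by rewrite scalerDr !scalerA mulrC.
Qed.

Hypothesis T_onto : forall (c : F) g, exists f, T f - c *: f = g.
Hypothesis T_eigen : forall c : F, exists2 f : M, f != 0 & T f = c *: f.

(** Over a closed field [p] splits, so the equation is solved one linear factor at a time by
    [T_onto]. *)
Lemma polyact_onto (p : {poly F}) g : p != 0 -> exists f, polyact p f = g.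
Proof.
have [r ->] := closed_field_poly_normal p => nz0.
have {nz0} nz : lead_coef p != 0 by apply: contraNneq nz0 => ->; rewrite scale0r.
have [f fE] : exists f, polyact (\prod_(z <- r) ('X - z%:P)) f = (lead_coef p)^-1 *: g.
  elim: r (_ *: g) => [|z r IH] g'; first by exists g'; rewrite big_nil polyactC scale1r.
  have [g1 <-] := T_onto z g'; have [f fE] := IH g1.
  by exists f; rewrite big_cons polyactXsubC fE.
by exists f; rewrite polyactZ fE scalerA divff // scale1r.
Qed.

(** A non-constant [p] has a root [z]; an eigenvector for [z] is killed by the innermost factor, and
    the other factors preserve 0. *)
Lemma polyact_ker (p : {poly F}) : (1 < size p)%N -> exists2 f, f != 0 & polyact p f = 0.
Proof.
have [r ->] := closed_field_poly_normal p.
case/lastP: r => [|r z] sz.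
  move: sz; rewrite big_nil => /leq_trans/(_ (size_scale_leq _ _)).
  by rewrite size_poly1.
have [f f0 Tf] := T_eigen z; exists f => //.
rewrite polyactZ; apply/eqP; rewrite scaler_eq0; apply/orP; right; apply/eqP.
elim: r {sz} => [|y r IH].
  by rewrite big_seq1 -['X - _]mulr1 polyactXsubC polyactC scale1r Tf subrr.
by rewrite big_cons polyactXsubC IH linear0 scaler0 subrr.
Qed.

End PolynomialAction.

(** * The forward recursion and its polynomial form *)

Section WaveSequence.
Variables (F : closedFieldType) (M : lmodType F) (T : {linear M -> M}).
Hypothesis two_neq0 : (2 : F) != 0.

(** The state after [n] steps is the pair of values at times [n] and [n + 1], turning the
    second-order recursion into a first-order one. *)
Fixpoint waveseq (a b : M) (n : nat) : M * M :=
  if n is m.+1 then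
    let: (x, y) := waveseq a b m in (y, 2 *: T y - x)
  else (a, b).

Lemma waveseqSS a b n : (waveseq a b n.+2).1 =
  2 *: T (waveseq a b n.+1).1 - (waveseq a b n).1.
Proof. by rewrite /=; case: (waveseq a b n). Qed.

(* [W] and [U] are Chebyshev polynomials of the second kind: [W = U_(n-1)],
   [U = - U_(n-2)]. *)
Lemma waveseq_polyact n : exists U W : {poly F}, size W = n /\
  forall a b, (waveseq a b n).1 = polyact T W b + polyact T U a.
Proof.
(* The induction needs both components of the state. *)
suff [U [W [U' [W' [[]]]]]] : exists U W U' W' : {poly F},
    [/\ size W = n, size W' = n.+1,
      forall a b, (waveseq a b n).1 = polyact T W b + polyact T U a &
      forall a b, (waveseq a b n).2 = polyact T W' b + polyact T U' a].
  by exists U, W.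
elim: n => [|n [U [W [U' [W' [sW sW' eW eW']]]]]].
  exists 1, 0, 0, 1; rewrite size_poly0 size_poly1; split=> // a b /=.
    by rewrite -[1]/(1%:P) -[0]/(0%:P) !polyactC scale1r scale0r add0r.
  by rewrite -[1]/(1%:P) -[0]/(0%:P) !polyactC scale1r scale0r addr0.
exists U', W', (2 *: ('X * U') - U), (2 *: ('X * W') - W).
split => // [|a b|a b].
(* As 2 is non-zero, the degree rises by exactly one; [W] is too small to cancel the leading
   term. *)
- have s2 : size (2 *: ('X * W')) = n.+2.
    rewrite size_scale // mulrC size_mulX ?sW' //.
    by rewrite -size_poly_gt0 sW'.
  by rewrite size_polyDl // size_polyN s2 sW.
- by rewrite /= -eW'; case: (waveseq a b n).
rewrite /= 2!polyactB 2!polyactZ 2!polyactX addrACA -opprD -eW.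
rewrite -scalerDr -linearD -eW'.
by case: (waveseq a b n).
Qed.

End WaveSequence.

(** * Two-sided waves and the boundary conditions *)

Section Waves.
Variables (R : realType) (q : nat) (V : choiceType) (adj : rel V).
Hypothesis deg : forall v : V, (neighbours adj v #= `I_q.+1)%card.
Local Notation C := R[i].
Local Notation T := (mean_linear R deg).

(* The wave equation is invariant under [j |-> - j], so negative times are
   reached by running the forward recursion from [f_0] and
   [f_(-1) = 2 mu_1 f_0 - f_1]. *)
Definition wave_of (a b : V -> C^o) (j : int) : V -> C :=
  match j with
  | Posz n => (waveseq T a b n).1
  | Negz n => (waveseq T a (2 *: T a - b) n.+1).1
  end.

Lemma wave_of_wave a b : wave q adj (wave_of a b).
Proof.
have nz2 : (2 : C) != 0 by rewrite pnatr_eq0.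
have waveE (x y z : V -> C^o) v : z = 2 *: T y - x -> mu1 q adj y v = (z v + x v) / 2.
  move=> ->; apply: (mulIf nz2); rewrite mulfVK // mulrC.
  by rewrite -[RHS]/(2 * mu1 q adj y v - x v + x v) subrK.
(* For [j = 0] and [j = -1] the three times involved straddle both branches of [wave_of]; the other
   cases stay in one branch. *)
move=> j v; case: j => [[|n]|[|n]].
- by rewrite [0 + 1]add0r [0 - 1]sub0r addrC; apply: waveE.
- have -> : n.+1%:Z + 1 = n.+2 by rewrite addrC.
  have -> : n.+1%:Z - 1 = n by rewrite -addn1 PoszD addrK.
  by apply: waveE; rewrite /wave_of waveseqSS.
- by rewrite addrC; apply: waveE.
rewrite addrC.
have -> : Negz n.+1 + 1 = Negz n by rewrite !NegzE -[n.+2]addn1 PoszD opprD subrK.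
have -> : Negz n.+1 - 1 = Negz n.+2 by rewrite !NegzE -opprD -PoszD addn1.
by apply: waveE; rewrite /wave_of waveseqSS.
Qed.

End Waves.

Theorem theorem4p4 (R : realType) (q : nat) (hq : (1 <= q)%N)
    (V : choiceType) (adj : rel V) (htree : homogeneous_tree q adj)
    (k : int) (hk : 2 <= k) (g h : V -> R[i]) :
  infinite_set
    [set f : int -> V -> R[i] | [/\ wave q adj f, f 0 = g & f k = h]].
Proof.
case: htree => tree deg; case: k hk => [n|//] n_ge2.
pose T := mean_linear R deg.
have onto := mean_shift_onto deg hq tree : forall c g, exists f, T f - c *: f = g.
have eigen := mean_eigen deg hq tree : forall c, exists2 f, f != 0 & T f = c *: f.
have nz2 : (2 : R[i]) != 0 by rewrite pnatr_eq0.
have [U [W [sW eW]]] := waveseq_polyact T nz2 n.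
(* Here [k >= 2] enters: it makes [W] non-constant, hence its kernel non-zero. *)
have sW1 : (1 < size W)%N by rewrite sW.
have [b1 b1_neq0 Wb1] := polyact_ker eigen sW1.
have W_neq0 : W != 0 by rewrite -size_poly_gt0 ltnW.
have [b0 Wb0] := polyact_onto onto (h - polyact T U g) W_neq0.
(* [f_1] is the particular solution [b0] plus a multiple of the kernel element [b1]; natural
   multiples already differ in characteristic 0. *)
pose F (m : nat) := wave_of deg g (m%:R *: b1 + b0).
have injF : injective F.
  (* Evaluation at time 1 recovers the chosen [f_1]. *)
  move=> m1 m2 /(congr1 (fun f => f 1)) /= eqF.
  have /eqP : m1%:R *: b1 = m2%:R *: b1 :> (V -> R[i]^o) by apply: (addIr b0).
  rewrite -subr_eq0 -scalerBl scaler_eq0 (negPf b1_neq0) orbF subr_eq0.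
  by rewrite eqr_nat => /eqP.
apply: (@sub_infinite_set _ (range F)).
  move=> _ [m _ <-]; split => //; first exact: wave_of_wave.
  by rewrite /F /= eW polyact_linear Wb1 scaler0 add0r Wb0 subrK.
rewrite (eq_finite_set (inj_card_eq (in2W injF))); exact: infinite_nat.
Qed.
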